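(* Let $M$ be an infinite subset of $\mathbb{N}$, let $l\in\mathbb{N}$ and let $\mathcal{F}$ be a regular thin family. Then for every finite coloring of $\mathrm{Plm}_l(\mathcal{F}\upharpoonright M)$ there exists an infinite subset $L$ of $M$ such that $\mathrm{Plm}_l(\mathcal{F}\upharpoonright L)$ is monochromatic.
   Context: $\mathbb{N}=\{1,2,\dots\}$; $[\mathbb{N}]^{<\infty}$ is the set of finite subsets of $\mathbb{N}$. For a finite set $s\subset\mathbb{N}$, $|s|$ is its cardinality and $s(k)$ its $k$-th element in increasing order; $t\sqsubseteq s$ means that $t$ is an initial segment of $s$. For $\mathcal{F}\subseteq[\mathbb{N}]^{<\infty}$ let $\widehat{\mathcal{F}}=\{t:\exists s\in\mathcal{F},\ t\sqsubseteq s\}$ and $\mathcal{F}\upharpoonright M=\{s\in\mathcal{F}:s\subseteq M\}$. $\mathcal{F}$ is thin if no element of $\mathcal{F}$ is a proper initial segment of another. A family is regular if it is hereditary (closed under subsets), spreading (if $\{n_1<\dots<n_k\}$ is in the family, $m_1<\dots<m_k$ and $n_i\le m_i$ for all $i$, then $\{m_1,\dots,m_k\}$ is in the family) and compact (its set of characteristic functions is closed in $\{0,1\}^{\mathbb{N}}$). $\mathcal{F}$ is regular thin if it is thin and $\widehat{\mathcal{F}}$ is regular. A tuple $(s_1,\dots,s_l)$ of nonempty finite subsets of $\mathbb{N}$ is plegma if (i) $s_i(k)<s_j(k)$ whenever $1\le i<j\le l$ and $k\le\min(|s_i|,|s_j|)$, and (ii) $s_i(k)<s_j(k+1)$ for all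 $i,j\in\{1,\dots,l\}$ and $k\le\min(|s_i|,|s_j|-1)$. $\mathrm{Plm}_l(\mathcal{F})$ is the set of all plegma $l$-tuples with all entries in $\mathcal{F}$. *)

(* Defs.v *)
From mathcomp Require Import all_boot finmap.
From mathcomp Require Import boolp classical_sets cardinality topology.
From mathcomp Require Import cantor.

Set Implicit Arguments.
Unset Strict Implicit.
Unset Printing Implicit Defensive.

Local Open Scope classical_set_scope.

(* The natural numbers start at 1 here: sets of natural numbers are subsets of
   posN, and families of finite sets are subsets of finsets_posN. *)
Definition posN : set nat := [set n | 0 < n].

Definition finsets_posN : set {fset nat} := [set s | [set` s] `<=` posN].

Definition incr_enum (s : {fset nat}) : seq nat := sort leq s.

(* The index is 0-based: elt s k is the (k+1)-th element of s in increasing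
   order. It is meaningful only for k < #|` s|. *)
Definition elt (s : {fset nat}) (k : nat) : nat := nth 0 (incr_enum s) k.

Definition initial_segment (t s : {fset nat}) : Prop :=
  prefix (incr_enum t) (incr_enum s).

Definition hat (F : set {fset nat}) : set {fset nat} :=
  [set t | exists2 s, F s & initial_segment t s].

Definition restr (F : set {fset nat}) (M : set nat) : set {fset nat} :=
  [set s | F s /\ [set` s] `<=` M].

Definition thin (F : set {fset nat}) : Prop :=
  forall s t, F s -> F t -> ~ (initial_segment t s /\ t <> s).

Definition hereditary (F : set {fset nat}) : Prop :=
  forall s t, F s -> (t `<=` s)%fset -> F t.

Definition spreading (F : set {fset nat}) : Prop :=
  forall s t, F s -> #|` t| = #|` s| ->
    (forall k, k < #|` s| -> elt s k <= elt t k) -> F t.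

Definition char_fun (s : {fset nat}) : cantor_space := fun n => n \in s.

(* For F included in finsets_posN, the coordinate 0 of every characteristic
   function is false, so being closed in {0,1}^{0,1,2,...} is the same as being
   closed in {0,1}^{1,2,...}. *)
Definition compact_family (F : set {fset nat}) : Prop :=
  closed (char_fun @` F).

Definition regular (F : set {fset nat}) : Prop :=
  [/\ hereditary F, spreading F & compact_family F].

Definition regular_thin (F : set {fset nat}) : Prop :=
  thin F /\ regular (hat F).

(* With 0-based k, the bounds k <= min(|s_i|,|s_j|) and k <= min(|s_i|,|s_j|-1)
   on 1-based indices become strict. *)
Definition plegma (l : nat) (s : l.-tuple {fset nat}) : Prop :=
  [/\ forall i : 'I_l, tnth s i <> fset0,
      forall (i j : 'I_l) (k : nat), i < j ->
        k < minn #|` tnth s i| #|` tnth s j| ->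
        elt (tnth s i) k < elt (tnth s j) k
    & forall (i j : 'I_l) (k : nat),
        k < minn #|` tnth s i| (#|` tnth s j| - 1) ->
        elt (tnth s i) k < elt (tnth s j) k.+1].

Definition Plm (l : nat) (F : set {fset nat}) : set (l.-tuple {fset nat}) :=
  [set s | plegma s /\ forall i : 'I_l, F (tnth s i)].
Arguments Plm l F : clear implicits.

(* The values of c outside A are irrelevant; a total c lets the empty colouring
   of an empty A with r = 0 colours be represented. *)
Definition coloring (T : Type) (A : set T) (r : nat) (c : T -> nat) : Prop :=
  forall x, A x -> c x < r.

Definition monochromatic (T : Type) (c : T -> nat) (A : set T) : Prop :=
  exists a : nat, forall x, A x -> c x = a.

(* Main.v *)
(** In a thin family a plegma tuple is determined by the union of its entries:
    if the union of one plegma tuple is an initial segment of the union of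
    another, the tuples are equal. Hence, for each colour, either some infinite
    subset of M contains no union of a plegma tuple of this colour, or (Galvin's
    lemma) in some infinite L all infinite subsets have such a union as an
    initial segment; then every plegma tuple in L has this colour, because its
    union extends to an infinite subset of L. *)

Require Import Defs.
From mathcomp Require Import all_boot finmap.
From mathcomp Require Import boolp classical_sets cardinality topology.

Set Implicit Arguments.
Unset Strict Implicit.
Unset Printing Implicit Defensive.

Local Open Scope classical_set_scope.

(** * Unbounded sets of naturals and diagonalization *)

Definition unbounded (A : set nat) : Prop := forall n, exists2 m, n <= m & A m.

Definition above (s : set nat) : set nat := [set x | forall y, s y -> y < x].

Definition tail (n : nat) : set nat := [set x | n <= x].

Lemma infinite_unbounded (A : set nat) : infinite_set A <-> unbounded A.
Proof.
split=> [Ainf n|Aunb /finite_fsetP[X AX]].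
  apply: contrapT => nA; apply: Ainf.
  apply: (@sub_finite_set _ _ `I_n) (finite_II n) => x Ax /=.
  by rewrite ltnNge; apply/negP => nx; apply: nA; exists x.
have [m lem] := Aunb (\max_(x <- enum_fset X) x).+1.
rewrite AX /= => mX; move: lem; rewrite ltnNge => /negP; apply.
exact: (@leq_bigmax_seq _ (enum_fset X) predT id m mX isT).
Qed.

Lemma unbounded_tail (A : set nat) (n : nat) :
  unbounded A -> unbounded (A `&` tail n).
Proof.
move=> Aunb m; have [x] := Aunb (maxn m n).
by rewrite geq_max => /andP[mx nx] Ax; exists x.
Qed.

Lemma unbounded_min (A : set nat) :
  unbounded A -> exists2 a, A a & A `<=` tail a.
Proof.
move=> /(_ 0)[x0 _ Ax0].
have exA : exists x, `[<A x>] by exists x0; apply/asboolP.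
case: (ex_minnP exA) => a /asboolP Aa amin; exists a => // x Ax.
by apply: amin; apply/asboolP.
Qed.

(** The subsets of [I_m] are treated one after another, shrinking [N] each time; monotonicity of [D]
    keeps what has been achieved. *)
Lemma dense_initial (M : set nat) (m : nat) (D : set nat -> set nat -> Prop) :
  (forall N N' s, N' `<=` N -> D N s -> D N' s) ->
  (forall N s, N `<=` M -> unbounded N ->
    exists N', [/\ N' `<=` N, unbounded N' & D N' s]) ->
  forall N, N `<=` M -> unbounded N ->
    exists N', [/\ N' `<=` N, unbounded N' & forall s, s `<=` `I_m -> D N' s].
Proof.
elim: m D => [|m IHm] D Dmono Ddense N NM Nunb.
  have [N' [N'N N'unb DN']] := Ddense N set0 NM Nunb.
  exists N'; split=> // s; rewrite II0 => s0.
  by have -> : s = set0 by rewrite -subset0.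
have [N1 [N1N N1unb DN1]] := IHm D Dmono Ddense N NM Nunb.
have [|||N2 [N2N1 N2unb DN2]] :=
    IHm (fun N s => D N (s `|` [set m])) _ _ N1 _ N1unb.
- by move=> ? ? s /Dmono; apply.
- by move=> ? s; apply: Ddense.
- exact: subset_trans NM.
exists N2; split=> //; first exact: subset_trans N1N.
move=> s sm; have sD : s `\` [set m] `<=` `I_m.
  by move=> x [/sm /= xm /eqP xnm]; rewrite ltn_neqAle xnm.
have [smm|nsm] := pselect (s m).
  rewrite -(@setDUK _ [set m] s); last by move=> _ ->.
  by rewrite setUC; apply: DN2.
apply: Dmono N2N1 _; apply: DN1 => x sx; apply: sD; split=> //.
by move=> /= xm; apply: nsm; rewrite -xm.
Qed.

(* The two forcing constructions of Galvin's lemma are instances of this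
   diagonalization; [D N s] only depends on the part of [N] above [s]. *)
Lemma fusion (M : set nat) (D : set nat -> set nat -> Prop) :
  unbounded M ->
  (forall N N' s, N' `&` above s `<=` N -> D N s -> D N' s) ->
  (forall N s, N `<=` M -> unbounded N ->
    exists N', [/\ N' `<=` N, unbounded N' & D N' s]) ->
  exists L, [/\ L `<=` M, unbounded L &
    forall s n, s `<=` L -> s `<=` `I_n -> D L s].
Proof.
move=> Munb Dmono Ddense.
have Dsub N N' s : N' `<=` N -> D N s -> D N' s.
  by move=> N'N; apply: Dmono => x [/N'N].
have [N0 [N0M N0unb DN0]] := Ddense M set0 (@subset_refl _ M) Munb.
pose good N := N `<=` M /\ unbounded N.
(* A stage keeps a point [p.1] of [N] and settles all subsets of [I_p.1.+1] before going on above
   it. The premise [good N] makes [next] total, as choice requires. *)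
pose next (N : set nat) (p : nat * set nat) := good N ->
  [/\ N p.1, good p.2, p.2 `<=` N `&` tail p.1.+1 &
      forall s, s `<=` `I_p.1.+1 -> D p.2 s].
have /choice[f fP] : forall N, exists p, next N p.
  move=> N; have [[NM Nunb]|nN] := pselect (good N); last by exists (0, N).
  have [a Na _] := unbounded_min Nunb.
  have NaM : N `&` tail a.+1 `<=` M by move=> x [/NM].
  have [N' [N'N N'unb DN']] :=
    @dense_initial M a.+1 D Dsub Ddense _ NaM (unbounded_tail a.+1 Nunb).
  by exists (a, N') => _; split=> //; split=> // x /N'N [/NM].
pose N_ i := iter i (fun N => (f N).2) N0; pose a_ i := (f (N_ i)).1.
have Ngood i : good (N_ i) by elim: i => //= i IHi; case: (fP _ IHi).
have NS i : N_ i.+1 `<=` N_ i `&` tail (a_ i).+1 by case: (fP _ (Ngood i)).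
have Na i : N_ i (a_ i) by case: (fP _ (Ngood i)).
have DN i s : s `<=` `I_(a_ i).+1 -> D (N_ i.+1) s.
  by case: (fP _ (Ngood i)) => _ _ _; apply.
have Nle i j : i <= j -> N_ j `<=` N_ i.
  elim: j => [|j IHj]; first by rewrite leqn0 => /eqP->.
  rewrite leq_eqVlt => /predU1P[->//|/IHj Nij] x /NS[/Nij].
  by [].
have a_lt i j : i < j -> a_ i < a_ j.
  by move=> ij; have /NS[] := Nle _ _ ij _ (Na j).
exists (range a_); split.
- by move=> _ [i _ <-]; have [NM _] := Ngood i; apply: NM.
- have le_a n : n <= a_ n.
    by elim: n => // n IHn; apply: leq_ltn_trans IHn (a_lt _ _ _).
  by move=> n; exists (a_ n) => //; exists n.
move=> s n sL sn.
(* The least bound is [0] for empty [s], and otherwise [m.+1] with [m] the maximum of [s]. *)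
have exn : exists n, `[<s `<=` `I_n>] by exists n; apply/asboolP.
case: (ex_minnP exn) => -[|m] /asboolP sm mmin {n sn exn}.
  have -> : s = set0 by rewrite -subset0 -II0.
  by apply: Dmono DN0 => _ [[i _ <-] _]; apply: (Nle 0 i _ _ (Na i)).
have ssm : s m.
  apply: contrapT => nsm; suff /mmin : `[<s `<=` `I_m>] by rewrite ltnn.
  apply/asboolP => x sx /=; have := sm x sx; rewrite /= ltnS leq_eqVlt.
  by case/predU1P => // xm; case: nsm; rewrite -xm.
have [i _ aim] := sL m ssm; move: sm ssm mmin => sm ssm _; rewrite -aim in sm ssm.
(* The points of the range above [a_ i] are later [a_ j], all in [N_ i.+1]. *)
apply: Dmono (DN i s sm) => _ [[j _ <-] /(_ _ ssm) aij].
apply: Nle (Na j); rewrite ltnNge; apply/negP; rewrite leq_eqVlt.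
by case/predU1P => [ji|/a_lt aji]; [rewrite ji ltnn in aij |
  have := ltn_trans aij aji; rewrite ltnn].
Qed.

(** * Galvin's lemma by combinatorial forcing *)

Section Galvin.

Variable G : set (set nat).

Let accepts (N s : set nat) : Prop := forall X, X `<=` N -> X `<=` above s ->
  unbounded X -> exists k, G ((s `|` X) `&` `I_k).

(** Keeping [N'] above [s] makes this depend only on the part of [N] above [s], as [fusion]
    requires. *)
Let rejects (N s : set nat) : Prop := forall N', N' `<=` N `&` above s ->
  unbounded N' -> ~ accepts N' s.

Let accepts_mono (N N' s : set nat) :
  N' `&` above s `<=` N -> accepts N s -> accepts N' s.
Proof.
by move=> N'N acc X XN' Xs; apply: acc => // x Xx; apply: N'N; split; auto.
Qed.

Let rejects_mono (N N' s : set nat) :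
  N' `&` above s `<=` N -> rejects N s -> rejects N' s.
Proof.
by move=> N'N rej X XN'; apply: rej => x /XN' xN'; split;
  [exact: N'N | case: xN'].
Qed.

(** When no unbounded part of [N] above [s] accepts [s], [N] itself rejects it; so shrinking always
    reaches a decision, and [fusion] does so for all finite [s] at once. *)
Let decide (M : set nat) : unbounded M ->
  exists N, [/\ N `<=` M, unbounded N &
    forall s n, s `<=` N -> s `<=` `I_n -> accepts N s \/ rejects N s].
Proof.
move=> Munb.
apply: (@fusion M (fun N s => accepts N s \/ rejects N s)) => //.
  move=> N N' s N'N [acc|rej]; first by left; apply: accepts_mono acc.
  by right; apply: rejects_mono rej.
move=> N s _ Nunb.
have [[N' [N'N N'unb acc]]|nacc] := pselect
  (exists N', [/\ N' `<=` N `&` above s, unbounded N' & accepts N' s]).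
  by exists N'; split=> //; [move=> x /N'N[] | left].
by exists N; split=> //; right=> N' N'N N'unb acc; apply: nacc; exists N'.
Qed.

(* If [N] accepted [s U {n}] for unboundedly many [n], the set of these [n]
   would accept [s]: split a set at its minimum. *)
Let rejects_step (N s : set nat) (N' : set nat) :
  (forall s n, s `<=` N -> s `<=` `I_n -> accepts N s \/ rejects N s) ->
  N' `<=` N -> unbounded N' -> s `<=` N -> (exists n, s `<=` `I_n) ->
  rejects N s -> exists b, forall n, (N' `&` tail b) n -> above s n ->
    rejects N (s `|` [set n]).
Proof.
move=> Ndec N'N N'unb sN [k sk] rej.
pose B := [set n | [/\ N' n, above s n & accepts N (s `|` [set n])]].
have [b bB] : exists b, forall n, b <= n -> ~ B n.
  apply: contrapT => nb; apply: (rej B) => [n [/N'N]//||X XB Xs Xunb].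
    move=> n; apply: contrapT => nBn; apply: nb; exists n => m nm Bm.
    by apply: nBn; exists m.
  have [a Xa aX] := unbounded_min Xunb.
  have [_ _ acc] := XB a Xa.
  have [|||j] := acc (X `&` tail a.+1).
  - by move=> x [/XB[/N'N]].
  - move=> x [Xx ax] y [sy|->//]; exact: Xs Xx _ sy.
  - exact: unbounded_tail.
  have -> : s `|` [set a] `|` X `&` tail a.+1 = s `|` X; last by exists j.
  apply/seteqP; split=> x; first by case=> [[]|[]]; [left|move=> ->; right|right].
  case=> [sx|Xx]; first by left; left.
  have := aX x Xx; rewrite /tail /= leq_eqVlt => /predU1P[->|ax].
    by left; right.
  by right.
exists b => n [N'n bn] sn; have [||acc|//] := Ndec (s `|` [set n]) (maxn k n.+1).
- by move=> x [/sN//|->]; apply: N'N.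
- by move=> x [/sk /= xk|-> /=]; rewrite leq_max ?xk // leqnn orbT.
by case: (bB n bn).
Qed.

(** If the empty set is rejected, a second diagonalization lets rejection pass from [s] to [s] with
    a larger point added. Then all finite subsets of [L] are rejected, which no member of [G] can
    be. *)
Lemma galvin (M : set nat) : unbounded M ->
  exists L, [/\ L `<=` M, unbounded L &
    (forall s n, s `<=` L -> s `<=` `I_n -> ~ G s) \/
    (forall X, X `<=` L -> unbounded X -> exists k, G (X `&` `I_k))].
Proof.
move=> /decide[N [NM Nunb Ndec]].
have [acc|rej0] := Ndec set0 0 (@sub0set _ _) (@sub0set _ _).
  exists N; split=> //; right=> X XN Xunb.
  have [|k] := acc X XN _ Xunb; first by move=> x _ y [].
  by rewrite set0U; exists k.
(* Rejection stays relative to the fixed [N]; only the added point [n] ranges over the shrinking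
   [N']. *)
pose D (N' s : set nat) := s `<=` N -> (exists n, s `<=` `I_n) ->
  rejects N s -> forall n, N' n -> above s n -> rejects N (s `|` [set n]).
have [|||L [LN Lunb DL]] := @fusion N D => //.
- move=> N1 N2 s N21 D1 sN sfin rej n N2n sn.
  by apply: D1 => //; apply: N21.
- move=> N' s N'N N'unb.
  have [[sN sfin rej]|nD] := pselect
    [/\ s `<=` N, exists n, s `<=` `I_n & rejects N s]; last first.
    by exists N'; split=> // sN sfin rej; case: nD.
  have [b bP] := rejects_step Ndec N'N N'unb sN sfin rej.
  exists (N' `&` tail b); split; [by move=> x [] | exact: unbounded_tail |].
  by move=> _ _ _.
have Lrej s n : s `<=` L -> rejects N (s `&` `I_n).
  move=> sL; elim: n => [|n IHn]; first by rewrite II0 setI0.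
  have [sn|nsn] := pselect (s n).
    have -> : s `&` `I_n.+1 = (s `&` `I_n) `|` [set n].
      apply/seteqP; split=> x /=.
        by rewrite ltnS leq_eqVlt => -[sx /predU1P[->|]]; [right|left].
      by case=> [[sx /ltnW xn]|->].
    have snL : s `&` `I_n `<=` L by move=> x [/sL].
    have snn : s `&` `I_n `<=` `I_n by move=> x [].
    apply: (DL _ n snL snn _ _ IHn n (sL n sn)) => [x /snL/LN//||y []//].
    by exists n.
  have -> // : s `&` `I_n.+1 = s `&` `I_n.
  apply/seteqP; split=> x /= [sx]; last by move=> /ltnW.
  by rewrite ltnS leq_eqVlt => /predU1P[xn|//]; case: nsn; rewrite -xn.
exists L; split=> //; first exact: subset_trans NM.
left=> s n sL sn Gs; have := Lrej s n sL.
rewrite setIidl // => /(_ (N `&` tail n)); apply.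
- by move=> x [Nx nx]; split=> // y /sn /= yn; apply: leq_trans nx.
- exact: unbounded_tail.
(* Cutting at [n] gives back [s], a member of [G], whatever [X] is; so the tail of [N] accepts
   [s]. *)
move=> X XN _ _; exists n; have -> // : (s `|` X) `&` `I_n = s.
apply/seteqP; split=> x; last by move=> sx; split; [left|apply: sn].
by case=> -[//|/XN[_]]; rewrite /tail /= leqNgt => /negP.
Qed.

End Galvin.

(** * Ranks and agreement of finite sets *)

Section Plegma.

Lemma sorted_split (w : seq nat) (x : nat) : sorted leq w ->
  w = [seq y <- w | y < x] ++ [seq y <- w | x <= y].
Proof.
elim: w => //= a w IHw aw; have {}IHw := IHw (path_sorted aw).
case: (ltnP a x) => [ax|xa]; first by rewrite /= -IHw.
have: all (leq a) w by apply: order_path_min aw; apply: leq_trans.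
move=> /allP aw'.
have -> : [seq y <- w | y < x] = [::].
  apply/eqP; rewrite -[_ == _]negbK -has_filter; apply/hasPn => y /aw' ay.
  by rewrite -leqNgt (leq_trans xa).
by rewrite /= (@all_filterP _ _ _ _) //; apply/allP => y /aw'; apply: leq_trans.
Qed.

(** For [x] in [s] this is its 0-based position; other [x] are allowed so that components not
    containing [x] can be compared too. *)
Definition rank (s : {fset nat}) (x : nat) : nat :=
  count (fun y => y < x) (incr_enum s).

Lemma incr_enum_sorted (s : {fset nat}) : sorted leq (incr_enum s).
Proof. exact: sort_sorted leq_total _. Qed.

Lemma mem_incr_enum (s : {fset nat}) : incr_enum s =i s.
Proof. by move=> x; rewrite mem_sort. Qed.

Lemma size_incr_enum (s : {fset nat}) : size (incr_enum s) = #|` s|.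
Proof. by rewrite size_sort cardfE. Qed.

Lemma elt_le (s : {fset nat}) (i j : nat) :
  i <= j -> j < #|` s| -> elt s i <= elt s j.
Proof.
move=> ij js.
apply: (sorted_leq_nth leq_trans leqnn 0 (incr_enum_sorted s)) => //;
  by rewrite inE size_incr_enum // (leq_ltn_trans ij).
Qed.

Lemma rank_card (s : {fset nat}) (x y : nat) :
  y \in s -> x <= y -> rank s x < #|` s|.
Proof.
move=> ys xy; rewrite -size_incr_enum -(count_predC (fun y => y < x)).
rewrite -[X in X < _]addn0 ltn_add2l -has_count; apply/hasP.
by exists y; rewrite ?mem_incr_enum //= -leqNgt.
Qed.

(** The elements below [x] fill exactly the first [rank s x] places. *)
Lemma elt_rank_ge (s : {fset nat}) (x : nat) :
  rank s x < #|` s| -> x <= elt s (rank s x).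
Proof.
rewrite -size_incr_enum /elt /rank => ltk.
have eqw := sorted_split x (incr_enum_sorted s).
rewrite eqw nth_cat size_filter -eqw ltnn subnn.
move: ltk; rewrite -(count_predC (fun y => y < x)) -[X in X < _]addn0 ltn_add2l.
rewrite (@eq_count _ _ (leq x)); last by move=> y; rewrite /= -leqNgt.
rewrite -size_filter => lt0.
by have := mem_nth 0 lt0; rewrite mem_filter => /andP[].
Qed.

Lemma elt_rank (s : {fset nat}) (x : nat) : x \in s -> elt s (rank s x) = x.
Proof.
move=> xs; apply/eqP; rewrite eqn_leq elt_rank_ge ?(rank_card xs) // andbT.
rewrite -mem_incr_enum in xs.
have ltx : index x (incr_enum s) < #|` s| by rewrite -size_incr_enum index_mem.
have: elt s (index x (incr_enum s)) = x by rewrite /elt nth_index.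
move: (index _ _) ltx => i ltx eqx.
rewrite -{2}eqx elt_le // leqNgt; apply/negP => lt.
have eqw := sorted_split x (incr_enum_sorted s).
move: eqx; rewrite /elt eqw nth_cat size_filter lt => eqx.
have /(mem_nth 0) : i < size [seq y <- incr_enum s | y < x] by rewrite size_filter.
by rewrite eqx mem_filter ltnn.
Qed.

Definition agree_below (x : nat) (s t : {fset nat}) : Prop :=
  forall y, y < x -> (y \in s) = (y \in t).

Lemma filter_incr_enum (s t : {fset nat}) (x : nat) : agree_below x s t ->
  [seq y <- incr_enum s | y < x] = [seq y <- incr_enum t | y < x].
Proof.
move=> st; apply: (sorted_eq leq_trans anti_leq).
- by apply: sorted_filter (incr_enum_sorted s); apply: leq_trans.
- by apply: sorted_filter (incr_enum_sorted t); apply: leq_trans.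
apply: uniq_perm; rewrite ?filter_uniq ?sort_uniq ?fset_uniq // => y.
by rewrite !mem_filter !mem_incr_enum; case: ltnP => //= /st.
Qed.

Lemma rank_agree (s t : {fset nat}) (x : nat) :
  agree_below x s t -> rank s x = rank t x.
Proof. by move=> /filter_incr_enum e; rewrite /rank -!size_filter e. Qed.

(** All of [t] lies below [x], so agreement makes [t] an initial segment of [s], and thinness
    forbids a proper one. *)
Lemma thin_agree (F : set {fset nat}) (s t : {fset nat}) (x : nat) :
  thin F -> F s -> F t -> agree_below x s t ->
  (forall y, y \in t -> y < x) -> s = t.
Proof.
move=> Fthin Fs Ft st tx; apply: contrapT => nst.
apply: (Fthin s t) => //; split; last by move=> ts; apply: nst.
rewrite /initial_segment (sorted_split x (incr_enum_sorted s)).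
rewrite (filter_incr_enum st) (all_filterP _) ?prefix_prefix //.
by apply/allP => y; rewrite mem_incr_enum; apply: tx.
Qed.

(** * Plegma tuples and their unions *)

Variable l : nat.
Implicit Types s t : l.-tuple {fset nat}.

Definition support s : set nat := [set x | exists i, x \in tnth s i].

Lemma support_bounded s : exists n, support s `<=` `I_n.
Proof.
exists (\max_(i < l) \max_(y <- enum_fset (tnth s i)) y).+1 => x [i xs] /=.
rewrite ltnS; apply: leq_trans (leq_bigmax i).
exact: (@leq_bigmax_seq _ (enum_fset (tnth s i)) predT id x xs isT).
Qed.

(* A plegma tuple is read in the order of the pairs (rank, index). *)
Lemma plegma_order s (i j : 'I_l) (x y : nat) : plegma s ->
  x \in tnth s i -> y \in tnth s j -> x <= y ->
  rank (tnth s i) x <= rank (tnth s j) x /\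
  (rank (tnth s i) x = rank (tnth s j) x -> i <= j).
Proof.
case=> _ same_lvl next_lvl xi yj xy.
have ki := rank_card xi (leqnn x); have kj := rank_card yj xy.
have eqx := elt_rank xi; have lex := elt_rank_ge kj.
split.
  rewrite leqNgt; apply/negP => lt.
  have lt1 := leq_ltn_trans lt ki.
  (* The entry of component [j] at this rank is at least [x], yet [next_lvl] puts it below an entry
     of component [i] that is at most [x]. *)
  have := next_lvl j i (rank (tnth s j) x).
  rewrite leq_min kj ltn_subRL add1n lt1 => /(_ isT) ltS.
  have := leq_trans ltS (elt_le lt ki).
  by rewrite eqx ltnNge lex.
move=> eqk; rewrite leqNgt; apply/negP => ji.
have := same_lvl j i (rank (tnth s j) x) ji.
rewrite leq_min kj -{1}eqk ki => /(_ isT).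
by rewrite -{2}eqk eqx ltnNge lex.
Qed.

(* By induction on [x], the two tuples agree below [x]: their components are
   extended in the same order, and by thinness they end at the same time. *)
Lemma plegma_support_inj (F : set {fset nat}) s t (n : nat) : thin F ->
  Plm l F s -> Plm l F t -> support t = support s `&` `I_n -> s = t.
Proof.
move=> Fthin [plms Fs] [plmt Ft] supp.
have suppE x : x < n -> support s x <-> support t x.
  by move=> xn; rewrite supp; split=> [|[]].
have t_lt j y : y \in tnth t j -> y < n.
  move=> yt; have : support t y by exists j.
  by rewrite supp => -[].
have agree x j : agree_below x (tnth s j) (tnth t j).
  elim: x j => [//|x IHx] j y; rewrite ltnS leq_eqVlt.
  case/predU1P => [->{y}|]; last exact: IHx.
  (* A component ending below [x] would by thinness equal its counterpart, so neither could contain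
     [x]. *)
  have larger i : x \in tnth s i \/ x \in tnth t i ->
      (exists2 y, y \in tnth s i & x <= y) /\ (exists2 y, y \in tnth t i & x <= y).
    have agree_sym : agree_below x (tnth t i) (tnth s i).
      by move=> y yx; rewrite IHx.
    move=> xst; split; apply: contrapT => nex.
      have st : tnth t i = tnth s i.
        apply: (thin_agree Fthin (Ft i) (Fs i) agree_sym) => y ys.
        by rewrite ltnNge; apply/negP => xy; apply: nex; exists y.
      by apply: nex; exists x; case: xst; rewrite // st.
    have st : tnth s i = tnth t i.
      apply: (thin_agree Fthin (Fs i) (Ft i) (IHx i)) => y ys.
      by rewrite ltnNge; apply/negP => xy; apply: nex; exists y.
    by apply: nex; exists x; case: xst; rewrite // st.
  (* For the pairs (rank of [x], index), the order of [s] puts [i] no later than [i'] and that of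
     [t] the reverse; the ranks agree by induction. *)
  have same i i' : x \in tnth s i -> x \in tnth t i' -> i = i'.
    move=> xs xt.
    have [_ [y yt xy]] := larger i (or_introl xs).
    have [[z zs xz] _] := larger i' (or_intror xt).
    have [les eqs] := plegma_order plms xs zs xz.
    have [let_ eqt] := plegma_order plmt xt yt xy.
    rewrite -!(rank_agree (IHx _)) in let_ eqt.
    have eqk : rank (tnth s i) x = rank (tnth s i') x.
      by apply/eqP; rewrite eqn_leq les let_.
    by apply/val_inj/eqP; rewrite eqn_leq /= eqs // eqt.
  (* From [n] on, [tnth t j] has ended, and thinness makes the components equal. *)
  have [xn|nx] := ltnP x n; last first.
    by rewrite (thin_agree Fthin (Fs j) (Ft j) (IHx j)) // => y /t_lt yn;
      apply: leq_trans nx.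
  apply/idP/idP => xj.
    have [i xi] : support t x by apply/(suppE x xn); exists j.
    by rewrite (same _ _ xj xi).
  have [i xi] : support s x by apply/(suppE x xn); exists j.
  by rewrite -(same _ _ xi xj).
apply: eq_from_tnth => j; apply/fsetP => x.
exact: (agree x.+1).
Qed.

End Plegma.

(** * The Ramsey property, by induction on the number of colours *)

Lemma plegma_ramsey (l : nat) (F : set {fset nat}) (r : nat)
    (c : l.-tuple {fset nat} -> nat) (M : set nat) : thin F -> unbounded M ->
  coloring (Plm l (restr F M)) r c ->
  exists L, [/\ L `<=` M, unbounded L & monochromatic c (Plm l (restr F L))].
Proof.
move=> Fthin; have PlmF s N : Plm l (restr F N) s -> Plm l F s.
  by case=> plm sF; split=> // i; case: (sF i).
have PlmN s N : Plm l (restr F N) s -> support s `<=` N.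
  by case=> _ sF x [i]; case: (sF i) => _; apply.
elim: r M => [|r IHr] M Munb col; first by exists M; split=> //; exists 0 => s /col.
(* [G] collects the unions of tuples of the last colour [r]; if [L] avoids them, [r] colours
   remain. *)
pose G := [set support s | s in [set s | Plm l F s /\ c s = r]].
have [L [LM Lunb [nG|allG]]] := galvin G Munb.
  have [|L' [L'L L'unb mono]] := IHr L Lunb.
    move=> s sL; have sM : Plm l (restr F M) s.
      case: sL => plm sF; split=> // i; have [Fi siL] := sF i.
      by split=> //; apply: subset_trans siL LM.
    have := col s sM; rewrite ltnS leq_eqVlt => /predU1P[csr|//].
    have [n sn] := support_bounded s.
    by case: (nG _ n (PlmN _ _ sL) sn); exists s => //; split=> //; apply: PlmF sL.
  by exists L'; split=> //; apply: subset_trans LM.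
exists L; split=> //; exists r => t tL.
have [b tb] := support_bounded t; have Ft := PlmF _ _ tL.
(* The points of [L] from the bound [b] on prolong [support t] to an infinite set whose cut at [b]
   is [support t]. *)
have [||k [s [Fs <-] sE]] := allG (support t `|` L `&` tail b).
- by move=> x [/(PlmN _ _ tL)|[]].
- by move=> m; have [x mx Lx] := unbounded_tail b Lunb m; exists x => //; right.
(* Both supports are cuts of one set, so comparing [k] and [b] tells which is an initial segment of
   the other. *)
congr c; have [kb|bk] := leqP k b.
  apply: (plegma_support_inj (n := k) Fthin Ft Fs); rewrite sE.
  apply/seteqP; split=> x /= [tx xk]; split=> //; last by left.
  by case: tx => // -[_]; rewrite /tail /= leqNgt (leq_trans xk kb).
apply/esym/(plegma_support_inj (n := b) Fthin Fs Ft); rewrite sE.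
apply/seteqP; split=> x /=.
  by move=> tx; have xb := tb x tx; split=> //; split; [left|apply: ltn_trans bk].
by case=> -[[//|[_]]]; rewrite /tail /= leqNgt => /negP.
Qed.

Theorem theorem0p1 (M : set nat) (hM : M `<=` posN) (Minf : infinite_set M)
    (l : nat) (hl : 0 < l)
    (F : set {fset nat}) (hF : F `<=` finsets_posN) (Freg : regular_thin F)
    (r : nat) (c : l.-tuple {fset nat} -> nat)
    (hc : coloring (Plm l (restr F M)) r c) :
  exists L : set nat,
    [/\ L `<=` M, infinite_set L & monochromatic c (Plm l (restr F L))].
Proof.
have [Fthin _] := Freg.
have [L [LM /infinite_unbounded Linf mono]] :=
  plegma_ramsey Fthin ((infinite_unbounded M).1 Minf) hc.
by exists L.
Qed.
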